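(* Let $(G,\star,g)$ be a log-Euclidean Lie group equipped with a log-Euclidean metric $g$, let $H$ be a closed connected subgroup of $G$, and let $\pi:(G,g)\to(G/H,g^Q)$ be the quotient Riemannian submersion. A smooth section $\sigma:G/H\to G$ of $\pi$ is an isometric embedding of $(G/H,g^Q)$ into $(G,g)$ if and only if for all $[p]\in G/H$ and all $v\in T_{[p]}(G/H)$ one has $\mathrm d_{[p]}\sigma(v)\in\mathcal H_{\sigma([p])}$.
   Context: A log-Euclidean Lie group is a smooth manifold $G$ with a diffeomorphism $\log_G:G\to\mathfrak g$ onto a finite-dimensional real vector space $\mathfrak g$, equipped with the commutative Lie group law $u\star v=\log_G^{-1}(\log_G(u)+\log_G(v))$. A log-Euclidean metric on $G$ is a pullback $g=\log_G^*\langle\cdot,\cdot\rangle$ of an inner product on $\mathfrak g$ (equivalently, a bi-invariant metric). The vertical and horizontal spaces at $p\in G$ are $\mathcal V_p=\ker(\mathrm d_p\pi)$ and $\mathcal H_p=\ker(\mathrm d_p\pi)^\perp$ (orthogonal for $g_p$). $g^Q$ is the unique Riemannian metric on $G/H$ making $\pi$ a Riemannian submersion, i.e. such that $\mathrm d_p\pi:\mathcal H_p\to T_{\pi(p)}(G/H)$ is a linear isometry for every $p\in G$. A smooth section is a smooth $\sigma$ with $\pi\circ\sigma=\mathrm{id}_{G/H}$; it is an isometric embedding if it is a smooth embedding with $\sigma^*g=g^Q$. *)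

(* Defs.v *)
From HB Require Import structures.
From mathcomp Require Import all_boot all_order all_algebra.
From mathcomp Require Import all_classical all_reals all_analysis.
From mathcomp Require Import sesquilinear generic_quotient.

Set Implicit Arguments.
Unset Strict Implicit.
Unset Printing Implicit Defensive.

Import Order.TTheory GRing.Theory Num.Theory.
Import numFieldNormedType.Exports.

Local Open Scope classical_set_scope.
Local Open Scope ring_scope.

Section Calculus.
Context {R : realType} {E F : normedModType R}.

(* Meaningful for open U: derivatives at a point of U then only depend on the
   values of f on U.  E is finite-dimensional in all uses below. *)
Fixpoint Ck_on (k : nat) (U : set E) (f : E -> F) : Prop :=
  match k with
  | 0%N => forall x, U x -> {for x, continuous f}
  | k'.+1 => (forall x, U x -> differentiable f x) /\
             forall v : E, Ck_on k' U (fun x => 'D_v f x)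
  end.

Definition smooth_on (U : set E) (f : E -> F) : Prop := forall k, Ck_on k U f.

End Calculus.

Section Manifolds.
Context {R : realType}.

(* The values of chart_map outside chart_dom, and of chart_inv outside
   chart_map @` chart_dom, are irrelevant. *)
Record chart (E : normedModType R) (M : topologicalType) := Chart {
  chart_dom : set M ;
  chart_map : M -> E ;
  chart_inv : E -> M }.

Definition chart_img E M (c : chart E M) : set E :=
  chart_map c @` chart_dom c.

Definition atlas (E : normedModType R) (M : topologicalType) :=
  set (chart E M).

Definition is_chart E M (c : chart E M) : Prop :=
  [/\ open (chart_dom c), open (chart_img c),
      {in chart_dom c, cancel (chart_map c) (chart_inv c)},
      {in chart_dom c, continuous (chart_map c)} &
      {in chart_img c, continuous (chart_inv c)}].

Definition smooth_manifold n (M : topologicalType) (A : atlas 'rV[R]_n M)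
    : Prop :=
  [/\ hausdorff_space M, @second_countable M,
      (forall c, A c -> is_chart c),
      (forall p, exists2 c, A c & chart_dom c p) &
      (forall c d, A c -> A d ->
         smooth_on (chart_map c @` (chart_dom c `&` chart_dom d))
                   (chart_map d \o chart_inv c))].

Definition smooth_map E E' M N (A : atlas E M) (B : atlas E' N) (F : M -> N)
    : Prop :=
  continuous F /\
  forall c d, A c -> B d ->
    smooth_on (chart_map c @` (chart_dom c `&` F @^-1` chart_dom d))
              (chart_map d \o F \o chart_inv c).

Definition line_atlas : atlas R^o R^o := [set Chart setT id id].

Definition smooth_curve E M (A : atlas E M) (a : R -> M) : Prop :=
  smooth_map line_atlas A (a : R^o -> M).

Definition Cinfty E M (A : atlas E M) : set (M -> R) :=
  [set f | smooth_map A line_atlas (f : M -> R^o)].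

(* Tangent vectors at p are the operators f |-> (f \o a)'(0) on C^oo(M), for
   smooth curves a through p.  Functionals are extended by 0 to non-smooth
   functions, so that two tangent vectors are equal iff they agree on C^oo(M). *)
Definition tvec (M : Type) := (M -> R) -> R^o.

Definition velocity E M (A : atlas E M) (a : R -> M) : tvec M :=
  fun f => if f \in Cinfty A then derive1 (fun t => f (a t) : R^o) 0 else 0.

Definition tangent E M (A : atlas E M) (p : M) : set (tvec M) :=
  [set v | exists a, [/\ smooth_curve A a, a 0 = p & v = velocity A a]].

(* differential B F is d_pF on tangent vectors at any p, for F smooth. *)
Definition differential E M N (B : atlas E N) (F : M -> N) (v : tvec M)
    : tvec N :=
  fun f => if f \in Cinfty B then v (f \o F) else 0.

Definition metric_field (M : Type) := M -> tvec M -> tvec M -> R.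

Definition smooth_vector_field E M (A : atlas E M) (X : M -> tvec M) : Prop :=
  (forall p, tangent A p (X p)) /\
  forall f, Cinfty A f -> Cinfty A (fun p => X p f).

Definition riemannian_metric E M (A : atlas E M) (g : metric_field M) : Prop :=
  [/\ forall p (a : R) u v w,
        tangent A p u -> tangent A p v -> tangent A p w ->
        g p (a *: u + v) w = a * g p u w + g p v w,
      forall p u v, tangent A p u -> tangent A p v -> g p u v = g p v u,
      forall p u, tangent A p u -> u <> 0 -> 0 < g p u u &
      forall X Y, smooth_vector_field A X -> smooth_vector_field A Y ->
        Cinfty A (fun p => g p (X p) (Y p))].

Definition pullback E M N (B : atlas E N) (F : M -> N) (g : metric_field N)
    : metric_field M :=
  fun p u v => g (F p) (differential B F u) (differential B F v).

Definition vertical E E' M N (A : atlas E M) (B : atlas E' N) (F : M -> N)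
    (p : M) : set (tvec M) :=
  [set u | tangent A p u /\ differential B F u = 0].

Definition horizontal E E' M N (A : atlas E M) (B : atlas E' N)
    (g : metric_field M) (F : M -> N) (p : M) : set (tvec M) :=
  [set u | tangent A p u /\ forall w, vertical A B F p w -> g p u w = 0].

Definition smooth_submersion E E' M N (A : atlas E M) (B : atlas E' N)
    (F : M -> N) : Prop :=
  smooth_map A B F /\
  forall p, set_surj (tangent A p) (tangent B (F p)) (differential B F).

Definition riemannian_submersion E E' M N (A : atlas E M) (B : atlas E' N)
    (g : metric_field M) (h : metric_field N) (F : M -> N) : Prop :=
  smooth_submersion A B F /\
  forall p,
    set_bij (horizontal A B g F p) (tangent B (F p)) (differential B F) /\
    forall u v, horizontal A B g F p u -> horizontal A B g F p v ->
      h (F p) (differential B F u) (differential B F v) = g p u v.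

Definition smooth_embedding E E' M N (A : atlas E M) (B : atlas E' N)
    (F : M -> N) : Prop :=
  [/\ smooth_map A B F,
      forall p, set_inj (tangent A p) (differential B F),
      injective F &
      (* homeomorphism onto the image *)
      forall U : set M, open U ->
        exists2 W : set N, open W & F @` U = W `&` range F].

Definition isometric_embedding E E' M N (A : atlas E M) (B : atlas E' N)
    (h : metric_field M) (g : metric_field N) (F : M -> N) : Prop :=
  smooth_embedding A B F /\
  forall p u v, tangent A p u -> tangent A p v ->
    pullback B F g p u v = h p u v.

Definition smooth_section E E' M N (A : atlas E M) (B : atlas E' N)
    (F : M -> N) (s : N -> M) : Prop :=
  smooth_map B A s /\ cancel s F.

End Manifolds.

(* A finite-dimensional real vector space as a manifold, through its linear
   coordinates. *)
Import VectorInternalTheory.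

Section VectorSpace.
Context {R : realType} (V : vectType R).

Definition vect_space : topologicalType :=
  initial_topology (v2r : V -> 'rV[R]_(dim V)).

Definition vect_atlas : atlas 'rV[R]_(dim V) vect_space :=
  [set Chart setT (v2r : vect_space -> _) (r2v : _ -> vect_space)].

(* The inverse of the canonical isomorphism V -> T_xV, which sends a to the
   velocity at 0 of t |-> x + t a. *)
Definition tangent_to_vect (x : V) (v : tvec vect_space) : V :=
  xget 0 [set a : V |
    v = velocity vect_atlas (fun t : R => x + t *: a : vect_space)].

Definition vect_metric (ip : {dot V for idfun}) : metric_field vect_space :=
  fun x u v => ip (tangent_to_vect x u) (tangent_to_vect x v).

End VectorSpace.

Arguments vect_space {R} V.
Arguments vect_atlas {R} V.

Record logEuclidean (R : realType) := LogEuclidean {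
  le_carrier :> topologicalType ;
  le_dim : nat ;
  le_atlas : atlas 'rV[R]_le_dim le_carrier ;
  le_manifold : smooth_manifold le_atlas ;
  le_alg : vectType R ;
  le_log : le_carrier -> le_alg ;
  le_exp : le_alg -> le_carrier ;
  le_logK : cancel le_log le_exp ;
  le_expK : cancel le_exp le_log ;
  le_log_smooth :
    smooth_map le_atlas (vect_atlas le_alg) (le_log : _ -> vect_space le_alg) ;
  le_exp_smooth :
    smooth_map (vect_atlas le_alg) le_atlas (le_exp : vect_space le_alg -> _) }.

Arguments le_atlas {R} l.
Arguments le_log {R l}.
Arguments le_exp {R l}.

Section LogEuclidean.
Context {R : realType} (G : logEuclidean R).

Definition le_mul (u v : G) : G := le_exp (le_log u + le_log v).
Definition le_one : G := le_exp 0.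
Definition le_inv (u : G) : G := le_exp (- le_log u).

Definition le_metric (ip : {dot le_alg G for idfun}) : metric_field G :=
  pullback (vect_atlas (le_alg G)) (le_log : G -> vect_space (le_alg G))
    (vect_metric ip).

Record le_subgroup := LeSubgroup {
  sub_set :> set G ;
  sub_one : sub_set le_one ;
  sub_mul : forall u v, sub_set u -> sub_set v -> sub_set (le_mul u v) ;
  sub_inv : forall u, sub_set u -> sub_set (le_inv u) }.

Variable H : le_subgroup.

Definition coset_rel : rel G := fun u v => le_mul (le_inv u) v \in (H : set G).

Lemma coset_rel_refl : reflexive coset_rel.
Proof.
move=> u; rewrite /coset_rel inE /le_mul /le_inv le_expK addNr.
exact: sub_one.
Qed.

Lemma coset_rel_sym : symmetric coset_rel.
Proof.
suff imp u v : coset_rel u v -> coset_rel v u.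
  by move=> u v; apply/idP/idP => /imp.
rewrite /coset_rel !inE => /sub_inv; rewrite /le_inv /le_mul !le_expK.
by rewrite opprD opprK addrC.
Qed.

Lemma coset_rel_trans : transitive coset_rel.
Proof.
move=> v u w; rewrite /coset_rel !inE => uv vw.
have := sub_mul uv vw; rewrite /le_mul /le_inv !le_expK.
by rewrite addrA addrK.
Qed.

Canonical coset_equiv :=
  EquivRel coset_rel coset_rel_refl coset_rel_sym coset_rel_trans.

Definition quotient_space : topologicalType :=
  quotient_topology {eq_quot coset_equiv}%qT.

Definition quotient_map (p : G) : quotient_space :=
  \pi_{eq_quot coset_equiv}%qT p.

End LogEuclidean.

(* Main.v *)
(* Since pi \o sigma = id, d(pi) maps d(sigma)(v) to v.  If d(sigma)(v) is
   horizontal for all v, then g(d(sigma)(u), d(sigma)(v)) = gQ(u, v), because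
   d(pi) is isometric on horizontal vectors.  Conversely, let h be the horizontal
   lift of v at sigma(p): d(sigma)(v) - h is vertical, hence orthogonal to h, and
   if sigma is isometric then d(sigma)(v) and h have the same length
   gQ(v, v)^(1/2); by Pythagoras d(sigma)(v) = h.
   The last step takes place in the tangent space of G, which log identifies with
   the Lie algebra: by the chain rule, the velocity of a curve b in a vector
   space is determined by b(0) and, linearly, by b'(0). *)

Require Import Defs.
From HB Require Import structures.
From mathcomp Require Import all_boot all_order all_algebra.
From mathcomp Require Import all_classical all_reals all_analysis.
From mathcomp Require Import sesquilinear generic_quotient.

Set Implicit Arguments.
Unset Strict Implicit.
Unset Printing Implicit Defensive.

Import Order.TTheory GRing.Theory Num.Theory.
Import numFieldNormedType.Exports.

Local Open Scope classical_set_scope.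
Local Open Scope ring_scope.

(** * Differentiability at a point and the product rule *)

Section CalculusLemmas.
Context {R : realType}.
Implicit Types E F : normedModType R.

(** The first-order expansion of [f] at [x] serves for [g] too, because its remainder is tested only
    near [x]; uniqueness then makes ['d f x] the differential of [g]. *)
Lemma near_eq_differentiable E F (f g : E -> F) (x : E) :
  {near x, f =1 g} -> differentiable f x -> differentiable g x.
Proof.
move=> fg df.
have gx : g x = f x by rewrite (nbhs_singleton fg).
have dfc : continuous ('d f x) by exact: diff_continuous.
have dg : g \o shift x = cst (g x) + 'd f x +o_ 0 id.
  apply/eqaddoP => e e0.
  have /eqaddoP/(_ _ e0) h := diff_locally df.
  have fg0 : \forall y \near (0 : E), f (y + x) = g (y + x).
    by move/nbhs0P: fg; apply: filterS => y; rewrite addrC.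
  rewrite gx; near=> y.
  suff -> : (g \o shift x - (cst (f x) + 'd f x)) y =
            (f \o shift x - (cst (f x) + 'd f x)) y by near: y.
  rewrite /= !fctE /=; congr (_ - _).
  by apply/esym; near: y.
by apply/diff_locallyP; rewrite (diff_unique dfc dg).
Unshelve. all: by end_near. Qed.

Lemma scaler_is_bilinear F :
  bilinear_for (GRing.Scale.Law.clone _ _ *:%R _)
    (GRing.Scale.Law.clone _ _ *:%R _) (@GRing.scale R F : R -> F -> F).
Proof.
split=> [u'|u] a x y /=.
- by rewrite scalerDl scalerA.
- by rewrite scalerDr !scalerA mulrC.
Qed.

HB.instance Definition _ F := bilinear_isBilinear.Build R R F F _ _
  (@GRing.scale R F : R -> F -> F) (scaler_is_bilinear F).

(** Scaling is a continuous bilinear map, composed here with the pair [(h, f)]. *)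
Lemma is_diff_scale E F (h : E -> R) (f : E -> F) (x : E) :
  differentiable h x -> differentiable f x ->
  is_diff x (fun y => h y *: f y)
            (fun v => h x *: 'd f x v + 'd h x v *: f x).
Proof.
move=> dh df.
have sc : continuous (fun p : R * F => p.1 *: p.2).
  by move=> p; exact: scale_continuous.
have ds : differentiable (fun p : R * F => p.1 *: p.2) (h x, f x).
  exact: (@differentiable_bilin _ R F F (@GRing.scale R F) _ sc).
have dp : differentiable (fun y => (h y, f y)) x by exact: differentiable_pair.
apply: DiffDef; first exact: (differentiable_comp dp ds).
rewrite (diff_comp dp ds) diff_pair//.
have -> := @diff_bilin _ R F F (@GRing.scale R F) (h x, f x) sc.
by [].
Qed.

End CalculusLemmas.

(** * Calculus of C^k maps *)

Section SmoothMaps.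
Context {R : realType}.
Implicit Types E F K : normedModType R.

Lemma Ck_onS E F k (U : set E) (f : E -> F) : Ck_on k.+1 U f -> Ck_on k U f.
Proof.
elim: k f => [|k ih] f /= [df Df].
  by move=> x Ux; apply: differentiable_continuous; exact: df.
by split=> // v; apply: ih; exact: Df.
Qed.

Lemma Ck_onW E F k (U V : set E) (f : E -> F) :
  V `<=` U -> Ck_on k U f -> Ck_on k V f.
Proof.
move=> VU; elim: k f => [|k ih] f /=; first by move=> cf x /VU; exact: cf.
by case=> df Df; split=> [x /VU|v]; [exact: df|exact: ih].
Qed.

(** [Ck_on] is a condition at each point on one globally defined function, so [V] may vary with [x]
    and be any set containing it. *)
Lemma Ck_on_local E F k (U : set E) (f : E -> F) :
  (forall x, U x -> exists2 V, V x & Ck_on k V f) -> Ck_on k U f.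
Proof.
elim: k f => [|k ih] f loc /=.
  by move=> x /loc[V Vx /(_ _ Vx)].
split=> [x /loc[V Vx [/(_ _ Vx)]]|v] //.
by apply: ih => x /loc[V Vx [_ /(_ v) Df]]; exists V.
Qed.

(** On an open set the equality holds near each point, so it passes to directional derivatives. *)
Lemma eq_Ck_on E F k (U : set E) (f g : E -> F) :
  open U -> {in U, f =1 g} -> Ck_on k U f -> Ck_on k U g.
Proof.
move=> oU; elim: k f g => [|k ih] f g fg /=.
  move=> cf x Ux; rewrite /prop_for /continuous_at.
  have fgx : {near x, f =1 g}.
    by near=> y; apply: fg; rewrite inE; near: y; exact: open_nbhs_nbhs.
  by rewrite -(nbhs_singleton fgx); apply: cvg_trans (cf x Ux);
    apply: near_eq_cvg; apply: filterS fgx.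
have fgn x : U x -> {near x, f =1 g}.
  by move=> Ux; near=> y; apply: fg; rewrite inE; near: y; exact: open_nbhs_nbhs.
case=> df Df; split=> [x Ux|v].
  exact: near_eq_differentiable (fgn x Ux) (df x Ux).
by apply: ih (Df v) => x; rewrite inE => /fgn; exact: near_eq_derive.
Unshelve. all: by end_near. Qed.

Lemma Ck_on_cst E F k (U : set E) (c : F) : Ck_on k U (fun=> c).
Proof.
elim: k c => [|k ih] c /=; first by move=> x _; exact: cvg_cst.
split=> [x _|v]; first exact: differentiable_cst.
by under eq_fun do rewrite derive_cst; exact: ih.
Qed.

Lemma Ck_onD E F k (U : set E) (f g : E -> F) : open U ->
  Ck_on k U f -> Ck_on k U g -> Ck_on k U (fun x => f x + g x).
Proof.
move=> oU; elim: k f g => [|k ih] f g /=.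
  by move=> cf cg x Ux; apply: cvgD; [exact: cf|exact: cg].
case=> [df Df] [dg Dg]; split=> [x Ux|v].
  by apply: differentiableD; [exact: df|exact: dg].
apply: (eq_Ck_on oU) (ih _ _ (Df v) (Dg v)) => x; rewrite inE => Ux.
by rewrite deriveD//; apply: diff_derivable; [exact: df|exact: dg].
Qed.

Lemma Ck_on_sum E F k n (U : set E) (f : 'I_n -> E -> F) : open U ->
  (forall i, Ck_on k U (f i)) -> Ck_on k U (fun x => \sum_i f i x).
Proof.
move=> oU Cf; elim: n f Cf => [|n ih] f Cf.
  by under eq_fun do rewrite big_ord0; exact: Ck_on_cst.
under eq_fun do rewrite big_ord_recl.
by apply: Ck_onD => //; apply: ih => i.
Qed.

Lemma Ck_onZ E F k (U : set E) (h : E -> R) (f : E -> F) : open U ->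
  Ck_on k U (h : E -> R^o) -> Ck_on k U f -> Ck_on k U (fun x => h x *: f x).
Proof.
move=> oU; elim: k h f => [|k ih] h f /=.
  by move=> ch cf x Ux; apply: cvgZ; [exact: ch|exact: cf].
case=> [dh Dh] [df Df].
have dhf x : U x -> differentiable (fun y => h y *: f y) x.
  by move=> Ux; have [] := is_diff_scale (dh x Ux) (df x Ux).
split=> // v.
have Chf : Ck_on k U (fun x => h x *: 'D_v f x + 'D_v (h : E -> R^o) x *: f x).
  (* Each product pairs a derivative, already C^k, with a factor whose order k + 1 is lowered to
     k. *)
  apply: Ck_onD => //; apply: ih => //; apply: Ck_onS; split=> //.
apply: (eq_Ck_on oU) Chf => x; rewrite inE => Ux.
rewrite [RHS]deriveE; last exact: dhf.
have [_ ->] := is_diff_scale (dh x Ux) (df x Ux).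
by rewrite !deriveE//; [exact: dh|exact: df].
Qed.

Lemma Ck_on_linear E F K k (U : set E) (f : E -> F) (L : {linear F -> K}) :
  open U -> continuous L -> Ck_on k U f -> Ck_on k U (L \o f).
Proof.
move=> oU cL; elim: k f => [|k ih] f /=.
  by move=> cf x Ux; apply: continuous_comp; [exact: cf|exact: cL].
case=> [df Df].
have dLf x : U x -> differentiable (L \o f) x.
  move=> Ux; apply: differentiable_comp; first exact: df.
  exact: linear_differentiable.
split=> // v.
apply: (eq_Ck_on oU) (ih _ (Df v)) => x; rewrite inE => Ux.
rewrite [RHS]deriveE; last exact: dLf.
rewrite diff_comp; [|exact: df|exact: linear_differentiable].
by rewrite /= deriveE; [rewrite diff_lin|exact: df].
Qed.

Lemma coord_is_linear n (i : 'I_n) : linear (fun u : 'rV[R]_n => u 0 i : R^o).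
Proof. by move=> a u v; rewrite !mxE. Qed.

Definition coordL n (i : 'I_n) : {linear 'rV[R]_n -> R^o} :=
  HB.pack (fun u : 'rV[R]_n => u 0 i : R^o)
    (GRing.isLinear.Build _ _ _ _ _ (@coord_is_linear n i)).

Lemma coordL_continuous n (i : 'I_n) : continuous (coordL i).
Proof. exact: coord_continuous. Qed.

Lemma Ck_on_coord E n k (U : set E) (f : E -> 'rV[R]_n) (i : 'I_n) : open U ->
  Ck_on k U f -> Ck_on k U ((fun x => f x 0 i) : E -> R^o).
Proof.
move=> oU.
by apply: (@Ck_on_linear _ _ _ _ _ _ (coordL i)) => //; exact: coordL_continuous.
Qed.

(* The chain rule expresses 'D_v (g \o f) through the partial derivatives of g
   along the standard basis, so that C^k.+1 reduces to C^k. *)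
Lemma Ck_on_comp E F n k (U : set E) (V : set 'rV[R]_n)
    (f : E -> 'rV[R]_n) (g : 'rV[R]_n -> F) : open U ->
  (forall x, U x -> V (f x)) ->
  Ck_on k U f -> Ck_on k V g -> Ck_on k U (g \o f).
Proof.
move=> oU UV; elim: k g => [|k ih] g /=.
  by move=> cf cg x Ux; apply: continuous_comp; [exact: cf|exact/cg/UV].
case=> [df Df] [dg Dg].
have dgf x : U x -> differentiable (g \o f) x.
  by move=> Ux; apply: differentiable_comp; [exact: df|exact/dg/UV].
split=> // v.
have Cgf : Ck_on k U
    (fun x => \sum_i 'D_v f x 0 i *: ('D_(delta_mx 0 i) g \o f) x).
  apply: Ck_on_sum => // i; apply: Ck_onZ => //.
    exact: (@Ck_on_coord _ _ _ _ ('D_v f)).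
  by apply: ih => //; exact: Ck_onS.
apply: (eq_Ck_on oU) Cgf => x; rewrite inE => Ux.
rewrite [RHS]deriveE; last exact: dgf.
rewrite diff_comp; [|exact: df|exact/dg/UV].
rewrite /= -(deriveE _ (df x Ux)).
rewrite [in RHS](row_sum_delta ('D_v f x)) linear_sum.
by apply: eq_bigr => i _; rewrite linearZ /= (deriveE _ (dg _ (UV _ Ux))).
Qed.

Lemma smooth_affine E F (L : {linear E -> F}) (c : F) :
  continuous L -> smooth_on setT (fun x => c + L x).
Proof.
move=> cL k; apply: Ck_onD; first exact: openT.
  exact: Ck_on_cst.
apply: (@Ck_on_linear _ _ _ k setT id L) => //; first exact: openT.
(* The identity is C^k because its directional derivatives are constant. *)
elim: k => [|k _] /=; first by move=> x _; exact: cvg_id.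
split=> [x _|v]; first exact: ex_diff.
by under eq_fun do rewrite derive_id; exact: Ck_on_cst.
Qed.

End SmoothMaps.

(** * Charts and composition of smooth maps *)

Section Charts.
Context {R : realType}.
Implicit Types E F : normedModType R.

(** The common ground of the atlases of G, G/H, the line and the Lie algebra, on which composition
    of smooth maps rests. *)
Definition charted E (M : topologicalType) (A : atlas E M) : Prop :=
  (forall c, A c -> is_chart c) /\ (forall p, exists2 c, A c & chart_dom c p).

Lemma smooth_manifold_charted n M (A : atlas 'rV[R]_n M) :
  smooth_manifold A -> charted A.
Proof. by case. Qed.

Lemma line_atlas_charted : charted (@line_atlas R).
Proof.
split=> [c ->|p]; last by exists (Chart setT id id).
split => //=; first exact: openT.
  by rewrite /chart_img /= image_id; exact: openT.
all: by move=> x _; exact: cvg_id.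
Qed.

(** Near [chart_map c p], a point [z] comes from [chart_inv c z], which stays in [O] by continuity
    of [chart_inv c]. *)
Lemma open_chart_image E M (c : chart E M) (O : set M) :
  is_chart c -> open O -> open (chart_map c @` (chart_dom c `&` O)).
Proof.
case=> odom oimg cK _ cinv oO; rewrite openE => _ [p [dp Op] <-].
have ip : chart_img c (chart_map c p) by exists p.
have cp := cinv _ (mem_set ip).
near=> z.
have [q dq qz] : chart_img c z by near: z; exact: open_nbhs_nbhs.
exists q => //; split=> //; rewrite -(cK _ (mem_set dq)) qz.
near: z; apply: cp; apply: open_nbhs_nbhs; split=> //=.
by rewrite cK ?inE.
Unshelve. all: by end_near. Qed.

(** Near each [p] the coordinate expression of [g \o f] factors through a chart at [f p]; locality
    of [Ck_on] then suffices. The middle atlas is modelled on row vectors, as [Ck_on_comp] uses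
    partial derivatives. *)
Lemma smooth_map_comp E F n M N P (A : atlas E M) (B : atlas 'rV[R]_n N)
    (C : atlas F P) (f : M -> N) (g : N -> P) :
  charted A -> charted B -> charted C ->
  smooth_map A B f -> smooth_map B C g -> smooth_map A C (g \o f).
Proof.
move=> [Achart _] [Bchart Bcover] [Cchart _] [cf sf] [cg sg].
split=> [x|c e Ac Ce k]; first by apply: continuous_comp; [exact: cf|exact: cg].
apply: Ck_on_local => _ [p [dp ep] <-].
have [d Bd dfp] := Bcover (f p).
(* [U] consists of the coordinates of points at which both factors are expressed in the charts [c],
   [d], [e]. *)
pose W := chart_dom d `&` g @^-1` chart_dom e.
pose U := chart_map c @` (chart_dom c `&` f @^-1` W).
have oU : open U.
  apply: open_chart_image; first exact: Achart.
  apply: open_comp => [y _|]; first exact: cf.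
  apply: openI; first by have [] := Bchart _ Bd.
  by apply: open_comp => [y _|]; [exact: cg|have [] := Cchart _ Ce].
have cK q : chart_dom c q -> chart_inv c (chart_map c q) = q.
  by move=> cq; have [_ _ cK _ _] := Achart _ Ac; rewrite cK ?inE.
have dK q : chart_dom d q -> chart_inv d (chart_map d q) = q.
  by move=> dq; have [_ _ dK _ _] := Bchart _ Bd; rewrite dK ?inE.
exists U; first by exists p.
have := sf c d Ac Bd k; have := sg d e Bd Ce k.
move=> /[swap] /(@Ck_onW _ _ _ _ _ U).
have UW : U `<=` chart_map c @` (chart_dom c `&` f @^-1` chart_dom d).
  by move=> _ [q [cq [dq _]] <-]; exists q.
move=> /(_ UW) Cf Cg.
have UV x : U x -> (chart_map d @` W) ((chart_map d \o f \o chart_inv c) x).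
  by move=> [q [cq Wq] <-] /=; rewrite cK//; exists (f q).
apply: (eq_Ck_on oU) (Ck_on_comp oU UV Cf Cg) => x.
by rewrite inE => -[q [cq [dq _]] <-] /=; rewrite cK// dK.
Qed.

Lemma Cinfty_comp E n M N (A : atlas E M) (B : atlas 'rV[R]_n N) (f : M -> N)
    (h : N -> R) : charted A -> charted B ->
  smooth_map A B f -> Cinfty B h -> Cinfty A (h \o f).
Proof.
move=> chA chB sf sh.
exact: (smooth_map_comp chA chB line_atlas_charted sf sh).
Qed.

End Charts.

(** * Differentials acting on tangent vectors *)

Section Differentials.
Context {R : realType}.

Lemma differentialB (F : normedModType R) M N (B : atlas F N) (f : M -> N)
    (u v : tvec M) :
  differential B f (u - v) = differential B f u - differential B f v.
Proof.
apply/funext => h; rewrite /differential !fctE /=.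
by case: ifP => // _; rewrite subr0.
Qed.

Context {n m : nat} {M N : topologicalType}.
Context {A : atlas 'rV[R]_n M} {B : atlas 'rV[R]_m N}.
Hypotheses (chA : charted A) (chB : charted B).

Lemma differential_velocity (f : M -> N) (a : R -> M) :
  smooth_map A B f -> differential B f (velocity A a) = velocity B (f \o a).
Proof.
move=> sf; apply/funext => h; rewrite /differential /velocity.
(* For smooth [h] the composite [h \o f] is smooth, so neither side takes the default value 0. *)
case: ifPn => //; rewrite inE => Bh; rewrite ifT// inE.
exact: Cinfty_comp Bh.
Qed.

Lemma tangent_differential (f : M -> N) (p : M) (v : tvec M) :
  smooth_map A B f -> tangent A p v -> tangent B (f p) (differential B f v).
Proof.
move=> sf [a [sa a0 ->]]; exists (f \o a); split.
- exact: (smooth_map_comp line_atlas_charted chA chB sa sf).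
- by rewrite /= a0.
- exact: differential_velocity.
Qed.

(** The curve [f \o s \o a] is [a] itself. This serves both for pi after [sigma] and for exp after
    log. *)
Lemma differentialK (f : M -> N) (s : N -> M) (p : N) (v : tvec N) :
  smooth_map A B f -> smooth_map B A s -> cancel s f -> tangent B p v ->
  differential B f (differential A s v) = v.
Proof.
move=> sf ss sK [a [_ _ ->]]; apply/funext => h.
rewrite /differential /velocity; case: ifPn => //; rewrite inE => Bh.
have Ah : Cinfty A (h \o f) by exact: Cinfty_comp Bh.
have Bhs : Cinfty B ((h \o f) \o s) by exact: Cinfty_comp Ah.
rewrite !ifT ?inE//; congr (derive1 _ 0).
by apply/funext => t /=; rewrite sK.
Qed.

End Differentials.

Import VectorInternalTheory.

(** * Tangent spaces of a vector space *)

Section TangentVect.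
Context {R : realType} (V : vectType R).
Let S : topologicalType := vect_space V.
Let AV := vect_atlas V.
Let coor : S -> 'rV[R]_(dim V) := v2r.

Let coor_continuous : continuous coor.
Proof. exact: initial_continuous. Qed.

Lemma continuous_to_vect (T : topologicalType) (f : T -> S) :
  continuous (coor \o f) -> continuous f.
Proof.
move=> /continuousP cf; apply/continuousP => _ [W oW <-].
by rewrite -comp_preimage; exact: cf.
Qed.

Lemma vect_atlas_charted : charted AV.
Proof.
split=> [c ->|p]; last by exists (Chart setT (v2r : S -> _) (r2v : _ -> S)).
have img : v2r @` [set: V] = setT.
  by rewrite -subTset => y _; exists (r2v y) => //; rewrite r2vK.
split => //=; rewrite /chart_img /= ?img.
- exact: openT.
- exact: openT.
- by move=> x _; rewrite v2rK.
- move=> y _; move: y; apply: continuous_to_vect => x.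
  rewrite (_ : _ \o _ = id); first exact: cvg_id.
  by apply/funext => y; rewrite /coor /= r2vK.
Qed.

Definition line (x a : V) : R -> S := fun t => x + t *: a.

Let coor_line x a t : coor (line x a t) = v2r x + t *: v2r a.
Proof. by rewrite /coor /line linearD linearZ. Qed.

Lemma smooth_line x a : smooth_curve AV (line x a).
Proof.
have slin : linear ( *:%R^~ (v2r a) : R^o -> _).
  by move=> u y z; rewrite scalerDl scalerA.
pose sM := GRing.isLinear.Build _ _ _ _ _ slin.
pose sL : {linear R^o -> 'rV[R]_(dim V)} :=
  HB.pack ( *:%R^~ (v2r a) : R^o -> _) sM.
have scont : continuous sL by exact: scalel_continuous.
have sline : smooth_on setT (fun t => v2r x + sL t) by exact: smooth_affine.
have lineE : coor \o line x a = fun t => v2r x + sL t.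
  by apply/funext => t; exact: coor_line.
split.
  apply: continuous_to_vect; rewrite lineE => t.
  exact: (sline 0%N).
move=> _ _ -> -> k; apply: (@Ck_onW _ _ _ _ setT) => //.
by have := sline k; rewrite -lineE.
Qed.

(** The coordinates are the test functions that separate tangent vectors. *)
Lemma smooth_coor (i : 'I_(dim V)) : Cinfty AV (fun y => coor y 0 i).
Proof.
have cc := @coordL_continuous R _ i.
split.
  by move=> y; apply: (@continuous_comp _ _ _ coor (coordL i));
    [exact: coor_continuous|exact: cc].
move=> _ _ -> -> k; apply: (@Ck_onW _ _ _ _ setT) => //=.
have := smooth_affine 0 cc k; congr Ck_on; apply/funext => y.
by rewrite add0r /= /coor r2vK.
Qed.

Lemma velocity_vectE (b : R -> S) : smooth_curve AV b ->
  velocity AV b = fun h => if h \in Cinfty AV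
    then 'd (h \o r2v : _ -> R^o) (v2r (b 0)) ('D_1 (coor \o b : R^o -> _) 0)
    else 0.
Proof.
move=> sb; apply/funext => h; rewrite /velocity; case: ifPn => //.
rewrite inE => -[_ sh].
have dh y : differentiable (h \o r2v : _ -> R^o) y.
  (* Smoothness at order 1 contains differentiability, and the chart covers every [y]. *)
  have [+ _] := sh _ _ erefl erefl 1%N.
  by apply; exists (r2v y) => //=; rewrite r2vK.
have db t : differentiable (coor \o b : R^o -> _) t.
  have [_ /(_ _ _ erefl erefl 1%N) [+ _]] := sb.
  by apply; exists t.
have hb : h \o b = (h \o r2v) \o (coor \o b).
  by apply/funext => t; rewrite /coor /= v2rK.
rewrite -/(h \o b) hb derive1E deriveE; last exact: differentiable_comp.
by rewrite diff_comp// [RHS]/= (deriveE _ (db 0)).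
Qed.

Lemma velocity_lineE x a :
  velocity AV (line x a) = fun h => if h \in Cinfty AV
    then 'd (h \o r2v : _ -> R^o) (v2r x) (v2r a) else 0.
Proof.
rewrite velocity_vectE; last exact: smooth_line.
rewrite /line scale0r addr0; congr (fun h => if _ then 'd _ _ _ else 0).
rewrite (_ : coor \o _ = cst (v2r x) + ( *:%R^~ (v2r a) : R^o -> _)).
  have [dl dlE] := is_diff_scalel (0 : R) (v2r a).
  rewrite deriveD; [|exact: derivable_cst|exact: diff_derivable].
  by rewrite derive_cst add0r deriveE// dlE scale1r.
by apply/funext => t; exact: coor_line.
Qed.

(** The line directed by the derivative of the curve at 0 has the same position and derivative
    there, hence the same velocity. *)
Lemma tangent_line x v : tangent AV x v ->
  exists a, v = velocity AV (line x a).
Proof.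
case=> b [sb b0 ->]; exists (r2v ('D_1 (coor \o b : R^o -> _) 0)).
by rewrite velocity_lineE velocity_vectE// b0 r2vK.
Qed.

(** Applying the velocity to the i-th coordinate function, which is linear, returns the i-th
    coordinate of the direction. *)
Lemma velocity_line_inj x : injective (fun a => velocity AV (line x a)).
Proof.
move=> a b; rewrite !velocity_lineE => ab.
apply: (can_inj (@v2rK R V)); apply/rowP => i.
have := congr1 (@^~ (fun y : S => coor y 0 i)) ab.
have -> /= : (fun y : S => coor y 0 i) \in Cinfty AV.
  by rewrite inE; exact: smooth_coor.
rewrite (_ : _ \o r2v = coordL i); last first.
  by apply/funext => y; rewrite /coor/= r2vK.
by rewrite !diff_lin//; exact: coordL_continuous.
Qed.

Lemma tangent_to_vect_line x a :
  tangent_to_vect x (velocity AV (line x a)) = a.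
Proof.
(* The default 0 of [xget] is never reached, since [a] is a witness; injectivity forces the chosen
   witness to be [a]. *)
rewrite /tangent_to_vect; case: xgetP => [b _ /= /velocity_line_inj //|].
by move=> /(_ a)/(_ erefl).
Qed.

Lemma tangent_to_vectK x v : tangent AV x v ->
  velocity AV (line x (tangent_to_vect x v)) = v.
Proof. by move=> /tangent_line[a ->]; rewrite tangent_to_vect_line. Qed.

(** At a fixed base point the velocity depends linearly on the direction, because a differential is
    linear. *)
Lemma velocity_lineB x a b :
  velocity AV (line x a) - velocity AV (line x b) = velocity AV (line x (a - b)).
Proof.
rewrite !velocity_lineE; apply/funext => h; rewrite !fctE.
by case: ifP => _; rewrite ?subr0// !linearB.
Qed.

Lemma tangent_to_vectB x u v : tangent AV x u -> tangent AV x v ->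
  tangent_to_vect x (u - v) = tangent_to_vect x u - tangent_to_vect x v.
Proof.
move=> /tangent_line[a ->] /tangent_line[b ->].
by rewrite velocity_lineB !tangent_to_vect_line.
Qed.

Lemma tangentB x u v : tangent AV x u -> tangent AV x v -> tangent AV x (u - v).
Proof.
move=> /tangent_line[a ->] /tangent_line[b ->]; rewrite velocity_lineB.
exists (line x (a - b)); split=> //; first exact: smooth_line.
by rewrite /line scale0r addr0.
Qed.

End TangentVect.

(** * Tangent spaces of G, read in the Lie algebra through log *)

Section LogEuclideanTangent.
Context {R : realType} (G : logEuclidean R).
Let AG := le_atlas G.
Let AV := vect_atlas (le_alg G).
Let log : G -> vect_space (le_alg G) := le_log.
Let exp : vect_space (le_alg G) -> G := le_exp.
Let chG : charted AG := smooth_manifold_charted (le_manifold G).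
Let chV : charted AV := vect_atlas_charted (le_alg G).

(** The differential of log at [p], with values in the Lie algebra: [le_metric ip p u v] is [ip] of
    the images of [u] and [v]. *)
Definition log_coord (p : G) (u : tvec G) : le_alg G :=
  tangent_to_vect (le_log p) (differential AV log u).

Let tangent_log p u : tangent AG p u ->
  tangent AV (log p) (differential AV log u).
Proof. apply: tangent_differential => //; exact: le_log_smooth. Qed.

Let differential_logK p u : tangent AG p u ->
  differential AG exp (differential AV log u) = u.
Proof.
apply: differentialK => //; [exact: le_exp_smooth|exact: le_log_smooth|].
exact: le_logK.
Qed.

(** A difference of velocities is not visibly the velocity of a curve in G; it becomes one by
    passing to the Lie algebra, taking a line there, and returning through exp. *)
Lemma le_tangentB p u v :
  tangent AG p u -> tangent AG p v -> tangent AG p (u - v).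
Proof.
move=> tu tv; rewrite -(differential_logK tu) -(differential_logK tv).
rewrite -differentialB.
have tuv := tangentB (tangent_log tu) (tangent_log tv).
have := tangent_differential chV chG (le_exp_smooth G) tuv.
by rewrite /log le_logK.
Qed.

Lemma log_coordB p u v : tangent AG p u -> tangent AG p v ->
  log_coord p (u - v) = log_coord p u - log_coord p v.
Proof.
move=> tu tv; rewrite /log_coord differentialB.
by rewrite tangent_to_vectB//; exact: tangent_log.
Qed.

Lemma log_coord_inj p u v : tangent AG p u -> tangent AG p v ->
  log_coord p u = log_coord p v -> u = v.
Proof.
move=> tu tv uv; rewrite -(differential_logK tu) -(differential_logK tv).
rewrite -(tangent_to_vectK (tangent_log tu)) -(tangent_to_vectK (tangent_log tv)).
by rewrite -!/(log_coord _ _) uv.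
Qed.

(* Pythagoras: g(w,w) = g(h,h) + g(w - h,w - h) when w - h is orthogonal to h. *)
Lemma le_metric_orthogonal_eq (ip : {dot le_alg G for idfun}) p w h :
  tangent AG p w -> tangent AG p h -> le_metric ip p h (w - h) = 0 ->
  le_metric ip p w w = le_metric ip p h h -> w = h.
Proof.
move=> tw th; rewrite /le_metric /pullback /vect_metric -!/(log_coord _ _).
rewrite log_coordB// => hd wh; apply: (log_coord_inj tw th).
move: hd wh; set x := log_coord p w; set y := log_coord p h => hd wh.
have ipC a b : ip a b = ip b a by rewrite hermC mul1r.
have ipB a b c : ip a (b - c) = ip a b - ip a c by exact: linearBr.
have yx : ip y x = ip y y by apply/subr0_eq; rewrite -ipB.
have dd : ip (x - y) (x - y) = 0.
  by rewrite ipB !(ipC (x - y)) hd subr0 ipB (ipC x y) yx wh subrr.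
(* By definiteness of [ip], a nonzero [x - y] would have a positive square. *)
apply/eqP; rewrite -subr_eq0; apply: contraT => /(@neq0_dnorm_gt0 _ _ _ ip).
by rewrite dd ltxx.
Qed.

End LogEuclideanTangent.

Theorem proposition4p13 (R : realType) (G : logEuclidean R)
    (ip : {dot le_alg G for idfun})
    (H : le_subgroup G)
    (Hclosed : closed (H : set G)) (Hconnected : connected (H : set G))
    (m : nat) (AQ : atlas 'rV[R]_m (quotient_space H))
    (hAQ : smooth_manifold AQ)
    (hpi : smooth_submersion (le_atlas G) AQ (quotient_map H))
    (gQ : metric_field (R := R) (quotient_space H))
    (hgQ : riemannian_metric AQ gQ)
    (hsub : riemannian_submersion (le_atlas G) AQ (le_metric ip) gQ
              (quotient_map H))
    (sigma : quotient_space H -> G)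
    (hsigma : smooth_section (le_atlas G) AQ (quotient_map H) sigma) :
  isometric_embedding AQ (le_atlas G) gQ (le_metric ip) sigma <->
  forall (p : quotient_space H) (v : tvec (R := R) (quotient_space H)),
    tangent AQ p v ->
    horizontal (le_atlas G) AQ (le_metric ip) (quotient_map H) (sigma p)
      (differential (le_atlas G) sigma v).
Proof.
have chG := smooth_manifold_charted (le_manifold G).
have chQ := smooth_manifold_charted hAQ.
have [[spi _] hgeo] := hsub.
have [ssig sigK] := hsigma.
have dpiK p v : tangent AQ p v -> differential AQ (quotient_map H)
    (differential (le_atlas G) sigma v) = v.
  by move=> tv; exact: (differentialK chG chQ spi ssig sigK tv).
have tsig p v : tangent AQ p v ->
    tangent (le_atlas G) (sigma p) (differential (le_atlas G) sigma v).
  exact: tangent_differential.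
split=> [[_ iso] p v tv|hor].
  have [[_ _ surj] hiso] := hgeo (sigma p).
  (* [h] is the horizontal lift of [v] at [sigma p]; it exists because pi sends [sigma p] back to
     [p], where [v] is tangent. *)
  have [|h [th hh] hv] := surj v; first by rewrite /= sigK.
  suff -> : differential (le_atlas G) sigma v = h by split.
  apply: (le_metric_orthogonal_eq (tsig _ _ tv) th (ip := ip)).
    (* Both vectors project to [v], so their difference is vertical and orthogonal to [h]. *)
    apply: hh; split; first exact: le_tangentB (tsig _ _ tv) th.
    by rewrite differentialB (dpiK p)// hv subrr.
  (* Both squared lengths equal [gQ p v v]. *)
  by rewrite -[RHS]hiso// hv sigK; exact: iso.
split.
  split=> //.
  (* The differential of pi is a left inverse of that of [sigma]. *)
  - move=> p u v; rewrite !inE => tu tv uv.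
    by rewrite -(dpiK p u tu) uv (dpiK p v tv).
  - exact: can_inj sigK.
  (* On the range of [sigma] the continuous map pi inverts [sigma], so the open preimage of [U]
     under pi cuts out the image of [U] there. *)
  - move=> U oU; exists (quotient_map H @^-1` U).
      by apply: open_comp => // x _; exact: spi.1.
    apply/seteqP; split=> [_ [x Ux <-]|y [/= Uy [x _ xy]]].
      by split; [rewrite /= sigK|exists x].
    by exists x => //; rewrite -(sigK x) xy.
move=> p u v tu tv; have [_ hiso] := hgeo (sigma p).
(* Both images are horizontal, so their product is the [gQ]-product of their projections, which are
   [u] and [v]. *)
rewrite /pullback -hiso; [|exact: hor|exact: hor].
by rewrite sigK (dpiK p)// (dpiK p).
Qed.
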